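(* Let $q \ge 2$ be the size of a finite field $\mathbb{F}_q$, and let $n \ge 1$ and $m \ge 0$ be integers. Let $\mathcal{Q}_{q,n}$ be the distribution of $n-\operatorname{rank}(M_n)$, where $M_n$ is chosen uniformly at random from all $n\times(n+m)$ matrices over $\mathbb{F}_q$, and let $\mathcal{Q}_q$ be the distribution on $\mathbb{N}_0$ with mass function $$p_k = \frac{1}{q^{k(m+k)}}\,\frac{\prod_{i=k+1}^{\infty}(1-1/q^i)}{\prod_{i=1}^{m+k}(1-1/q^i)},\qquad k\in\mathbb{N}_0 .$$ Then $$\frac{1}{8\,q^{n+m+1}} \le \|\mathcal{Q}_{q,n}-\mathcal{Q}_q\|_{\mathrm{TV}} \le \frac{3}{q^{n+m+1}} .$$
   Context: $\mathbb{N}_0=\{0,1,2,\dots\}$. Empty products equal $1$. For probability distributions $P_1,P_2$ on a countable set $S$, $\|P_1-P_2\|_{\mathrm{TV}}=\frac12\sum_{s\in S}|P_1(s)-P_2(s)|=\max_{A\subset S}|P_1(A)-P_2(A)|$; a distribution on $\{0,\dots,n\}$ is regarded as a distribution on $\mathbb{N}_0$. The distribution $\mathcal{Q}_{q,n}$ is known to be given on $\{0,1,\dots,n\}$ by the mass function $$p_{k,n}=\frac{1}{q^{k(m+k)}}\,\frac{\prod_{i=1}^{n+m}(1-1/q^i)\,\prod_{i=k+1}^{n}(1-1/q^i)}{\prod_{i=1}^{n-k}(1-1/q^i)\,\prod_{i=1}^{m+k}(1-1/q^i)} .$$ $\mathcal{Q}_q$ is the limit of $\mathcal{Q}_{q,n}$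 as $n\to\infty$. The parameter $m$ is suppressed in the notation for $\mathcal{Q}_{q,n}$, $\mathcal{Q}_q$, $p_{k,n}$, $p_k$. *)

(* Defs.v *)
From HB Require Import structures.
From mathcomp Require Import all_boot all_order all_algebra.
From mathcomp Require Import all_classical all_reals all_analysis.
Set Implicit Arguments.
Unset Strict Implicit.
Unset Printing Implicit Defensive.
Import Order.TTheory GRing.Theory Num.Theory.
Import numFieldNormedType.Exports.
Local Open Scope ring_scope.

(* Probability distributions on a countable set are given by their mass
   functions. The sum of absolute differences is taken in [\bar R], where it
   always exists, so no summability convention is involved. *)
Definition tv_dist (R : realType) (S : countType) (P1 P2 : S -> R) : \bar R :=
  ((2^-1)%:E * \esum_(s in [set: S]) `|P1 s - P2 s|%:E)%E.

(* The value at k is Prob(n - rank M = k) for M uniform among all n x (n + m)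
   matrices over F. The subtraction is not truncated, since rank M <= n. *)
Definition corank_mass (R : realType) (F : finFieldType) (n m : nat)
    (k : nat) : R :=
  #|[set M : 'M[F]_(n, n + m) | (n - \rank M)%N == k]|%:R
  / #|{: 'M[F]_(n, n + m)}|%:R.

(* The product of 1 - 1/q^i over all i > k. For q >= 2 the partial products are
   positive and nonincreasing, so [limn] is a genuine limit. *)
Definition euler_tail (R : realType) (q k : nat) : R :=
  limn (fun N : nat => \prod_(k.+1 <= i < N) (1 - 1 / q%:R ^+ i) : R).

Definition limit_mass (R : realType) (q m : nat) (k : nat) : R :=
  1 / q%:R ^+ (k * (m + k))
  * (euler_tail R q k / \prod_(1 <= i < (m + k).+1) (1 - 1 / q%:R ^+ i)).

(* Main.v *)
Require Import Defs.
From HB Require Import structures.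
From mathcomp Require Import all_boot all_order all_algebra.
From mathcomp Require Import mxabelem ring lra zify.
From mathcomp Require Import all_classical all_reals all_analysis.
Set Implicit Arguments.
Unset Strict Implicit.
Unset Printing Implicit Defensive.
Import Order.TTheory GRing.Theory Num.Theory.
Import numFieldNormedType.Exports.
Local Open Scope ring_scope.

(** Put x = 1/q, so that 0 <= x <= 1/2, write (x)_n for the product of the
    1 - x^i with 1 <= i <= n, and T_k for the product of the 1 - x^i with i > k.
    Write P_n and L for the corank mass and the limit mass.

    Counting matrices by rank gives P_n in closed form, and comparison with L
    gives, for k <= n,
      P_n(k) T_(n+m) (x)_(n-k) = L(k) (x)_n      ([mass_ratio]).
    The ratio P_n(k) / L(k) is thus 1 / T_(n+m) >= 1 at k = 0, while for k >= 1
    it is at most (1 - x^n) / T_(n+m), which is at most 1 because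
    T_(n+m) >= 1 - 2 x^(n+m+1) >= 1 - x^n. Hence P_n exceeds L only at k = 0.
    Both masses sum to 1, so the total variation distance is the excess at that
    single point ([tv_distE]):
      P_n(0) - L(0) = P_n(0) (1 - T_(n+m)).
    The bounds follow from x^(n+m+1) <= 1 - T_(n+m) <= 2 x^(n+m+1) and
    1/4 <= P_n(0) <= 1.

    That L has total mass 1 ([cvg_limit_mass_sum]) is a q-series identity, but
    it comes for free from the same comparison: P_n(k) <= L(k) for k >= 1
    bounds the partial sums of L from below by 1 - 2 x^n, and
    L(k) T_(n-k) <= P_n(k) bounds them from above by 1. *)

(** * Counting matrices by rank *)

Definition rank_count (F : finFieldType) (m n r : nat) : nat :=
  #|[set M : 'M[F]_(m, n) | \rank M == r]|.

Lemma rank_countE (F : finFieldType) (m n r : nat) :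
  rank_count F m n r = (\sum_(M : 'M[F]_(m, n)) (\rank M == r))%N.
Proof. by rewrite /rank_count cardsE -sum1_card big_mkcond. Qed.

Lemma rank_count0 (F : finFieldType) (m n : nat) : rank_count F m n 0 = 1%N.
Proof.
rewrite /rank_count (_ : [set _ | _] = [set 0%R]) ?cards1 //.
by apply/setP => M; rewrite !inE mxrank_eq0.
Qed.

Lemma mxrank_add_row (F : fieldType) (m n : nat) (u : 'rV[F]_n)
    (A : 'M[F]_(m, n)) :
  \rank (col_mx u A) = (~~ (u <= A)%MS + \rank A)%N.
Proof.
rewrite -(addsmxE u A); case: (boolP (u <= A)%MS) => [uA|uNA] /=.
  by rewrite (addsmx_idPr uA).
have u0 : u != 0 by apply: contraNneq uNA => ->; exact: sub0mx.
have /eqP uA0 : (u :&: A)%MS == 0.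
  have [le_rk eq_rk] := mxrank_leqif_sup (capmxSl u A).
  rewrite rank_rV u0 /= in le_rk eq_rk; rewrite -mxrank_eq0.
  apply: contraR uNA => rk0; apply: submx_trans (capmxSr u A).
  by rewrite -eq_rk eqn_leq le_rk lt0n.
by rewrite mxrank_disjoint_sum // rank_rV u0.
Qed.

Lemma card_row_in (F : finFieldType) (m n : nat) (A : 'M[F]_(m, n)) :
  (\sum_(u : 'rV[F]_n) (u <= A)%MS = #|F| ^ \rank A)%N.
Proof.
rewrite -(card_rowg A) -sum1_card [RHS]big_mkcond /=.
by apply: eq_bigr => u _; rewrite mem_rowg.
Qed.

Lemma card_row_notin (F : finFieldType) (m n : nat) (A : 'M[F]_(m, n)) :
  (\sum_(u : 'rV[F]_n) ~~ (u <= A)%MS + #|F| ^ \rank A = #|F| ^ n)%N.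
Proof.
have <- : #|{: 'rV[F]_n}| = (#|F| ^ n)%N by rewrite card_mx mul1n.
rewrite -(card_row_in A) -big_split /= -sum1_card.
by apply: eq_bigr => u _; case: (u <= A)%MS.
Qed.

(** Build the matrix one row at a time: a new row leaves the rank r unchanged for
    the q^r rows of the row space and raises it for the other q^n - q^r. The
    subtracted term stands on the left so that no truncated subtraction occurs. *)
Lemma rank_count_rec (F : finFieldType) (m n r : nat) :
  (rank_count F m.+1 n r.+1 + rank_count F m n r * #|F| ^ r =
   rank_count F m n r.+1 * #|F| ^ r.+1 + rank_count F m n r * #|F| ^ n)%N.
Proof.
have -> : (rank_count F m.+1 n r.+1 = \sum_(A : 'M[F]_(m, n))
    \sum_(u : 'rV[F]_n) (~~ (u <= A)%MS + \rank A == r.+1)%N)%N.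
  rewrite rank_countE exchange_big pair_big /=.
  rewrite (reindex (fun p : 'rV[F]_n * 'M[F]_(m, n) =>
    (col_mx p.1 p.2 : 'M[F]_(1 + m, n)))) /=.
    by apply: eq_bigr => -[u A] _ /=; rewrite mxrank_add_row.
  exists (fun M : 'M[F]_(1 + m, n) => (usubmx M, dsubmx M)) => [[u A]|M] _ /=.
    by rewrite col_mxKu col_mxKd.
  by rewrite vsubmxK.
rewrite !rank_countE !big_distrl -!big_split /=.
apply: eq_bigr => A _; have := card_row_notin A; have := card_row_in A.
have [e|ne] := eqVneq (\rank A) r.
  rewrite e => _ e2; rewrite !mul1n eqn_leq ltnn andbF mul0n add0n -e2.
  by congr addn; apply: eq_bigr => u _; case: (_ <= _)%MS; rewrite ?eqxx ?ltn_eqF.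
rewrite !mul0n !addn0 => e1 e2.
have [e|ne'] := eqVneq (\rank A) r.+1.
  rewrite mul1n -e -e1; apply: eq_bigr => u _.
  by case: (_ <= _)%MS; rewrite ?eqxx ?gtn_eqF.
rewrite mul0n big1 // => u _; case: (_ <= _)%MS => /=.
  by rewrite add0n (negPf ne').
by rewrite add1n eqSS (negPf ne).
Qed.

(** For q = #|F|, the number of r-tuples of linearly independent vectors in a
    space of dimension n over F. *)
Definition qfall (R : pzRingType) (q : R) (n r : nat) : R :=
  \prod_(i < r) (q ^+ n - q ^+ i).

Lemma qfallSr (R : pzRingType) (q : R) (n r : nat) :
  qfall q n r.+1 = qfall q n r * (q ^+ n - q ^+ r).
Proof. exact: big_ord_recr. Qed.

Lemma qfallSS (R : comPzRingType) (q : R) (n r : nat) :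
  qfall q n.+1 r.+1 = (q ^+ n.+1 - 1) * q ^+ r * qfall q n r.
Proof.
rewrite /qfall big_ord_recl expr0 -mulrA; congr (_ * _).
rewrite (eq_bigr (fun i : 'I_r => q * (q ^+ n - q ^+ i))); last first.
  by move=> i _; rewrite mulrBr -!exprS.
by rewrite big_split /= prodr_const card_ord.
Qed.

(** A matrix of rank r factors through an m x r matrix of full column rank and
    an r x n matrix of full row rank, uniquely up to an invertible r x r matrix.
    The proof checks instead that the formula satisfies [rank_count_rec]. With
    the denominator multiplied out it also covers r > m and r > n, where both
    sides vanish. *)
Lemma rank_count_frames (R : comPzRingType) (F : finFieldType) (m n r : nat) :
  let q := #|F|%:R : R in
  (rank_count F m n r)%:R * qfall q r r = qfall q m r * qfall q n r.
Proof.
move=> q; elim: m r => [|m IH] [|r].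
- by rewrite /qfall !big_ord0 !mulr1 rank_count0.
- rewrite (_ : rank_count F 0 n r.+1 = 0%N).
    by rewrite /qfall big_ord_recl [in RHS]big_ord_recl !expr0 subrr !mul0r.
  by rewrite rank_countE big1 // => M _; rewrite [M]flatmx0 mxrank0.
- by rewrite /qfall !big_ord0 !mulr1 rank_count0.
have := congr1 (fun k => k%:R : R) (rank_count_rec F m n r).
rewrite !natrD !natrM !natrX -/q => /(canRL (addrK _)) ->.
have e1 := IH r.+1; have e2 := IH r.
transitivity ((rank_count F m n r.+1)%:R * qfall q r.+1 r.+1 * q ^+ r.+1
   + (rank_count F m n r)%:R * qfall q r r * (q ^+ r.+1 - 1) * q ^+ r
     * (q ^+ n - q ^+ r)).
  by rewrite !qfallSS; ring.
by rewrite e1 e2 !qfallSS !qfallSr !exprS; ring.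
Qed.

(** * Finite and infinite products of the 1 - x^i *)

Definition qpoch (R : pzRingType) (x : R) (n : nat) : R :=
  \prod_(1 <= i < n.+1) (1 - x ^+ i).

Lemma qpochS (R : pzRingType) (x : R) (n : nat) :
  qpoch x n.+1 = qpoch x n * (1 - x ^+ n.+1).
Proof. by rewrite /qpoch big_nat_recr. Qed.

(** Factor q^(a+r) out of each of the r factors of [qfall]; the remaining
    factors are 1 - q^-j with a < j <= a + r. *)
Lemma qfall_qpoch (R : fieldType) (q : R) (a r : nat) : q != 0 ->
  qfall q (a + r) r * qpoch q^-1 a = q ^+ ((a + r) * r) * qpoch q^-1 (a + r).
Proof.
move=> q0; elim: r => [|r IH].
  by rewrite /qfall big_ord0 addn0 muln0 expr0.
rewrite addnS qfallSS qpochS -[LHS]mulrA IH.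
have -> : q ^+ ((a + r).+1 * r.+1) = q ^+ ((a + r) * r) * q ^+ r * q ^+ (a + r).+1.
  by rewrite -!exprD; congr (_ ^+ _); lia.
have e : q ^+ (a + r).+1 * q^-1 ^+ (a + r).+1 = 1.
  by rewrite exprVn mulfV ?expf_neq0.
rewrite -[X in X - 1]mulr1 -[X in _ - X]e; ring.
Qed.

Lemma expr_le_half (R : realFieldType) (x : R) (n : nat) :
  0 <= x <= 2^-1 -> 0 <= x ^+ n.+1 <= 2^-1.
Proof.
move=> /andP[x0 x1]; rewrite exprn_ge0 //= exprS.
have : x ^+ n <= 1 by rewrite exprn_ile1 //; lra.
by have := exprn_ge0 n x0; nra.
Qed.

Lemma factor_itv (R : realFieldType) (x : R) (n : nat) :
  0 <= x <= 2^-1 -> 0 < 1 - x ^+ n.+1 <= 1.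
Proof. by move=> /(expr_le_half n)/andP[h1 h2]; apply/andP; split; lra. Qed.

Lemma qpoch_itv (R : realFieldType) (x : R) (n : nat) :
  0 <= x <= 2^-1 -> 0 < qpoch x n <= 1.
Proof.
move=> hx; elim: n => [|n /andP[h1 h2]]; first by rewrite /qpoch big_geq // ltr01 lexx.
rewrite qpochS; have /andP[h3 h4] := factor_itv n hx.
by rewrite mulr_gt0 //= mulr_ile1 // ltW.
Qed.

Lemma qpoch_nonincr (R : realFieldType) (x : R) (m n : nat) :
  0 <= x <= 2^-1 -> (m <= n)%N -> qpoch x n <= qpoch x m.
Proof.
move=> hx; elim: n => [|n IH]; first by rewrite leqn0 => /eqP ->.
rewrite leq_eqVlt => /orP[/eqP ->//|/IH]; apply: le_trans.
rewrite qpochS ler_piMr //; first by case/andP: (qpoch_itv n hx) => /ltW.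
by case/andP: (factor_itv n hx).
Qed.

Definition qtail_prod (R : pzRingType) (x : R) (k N : nat) : R :=
  \prod_(k.+1 <= i < N) (1 - x ^+ i).

Definition qtail (R : realType) (x : R) (k : nat) : R := limn (qtail_prod x k).

Lemma euler_tailE (R : realType) (q k : nat) :
  euler_tail R q k = qtail q%:R^-1 k.
Proof.
rewrite /euler_tail /qtail /qtail_prod; congr (limn _); apply/funext => N.
by apply: eq_bigr => i _; rewrite div1r exprVn.
Qed.

(** The lower bound is 1 minus the sum of the x^i, estimated by the geometric
    series with 1 / (1 - x) <= 2; keeping the term at the upper end of the sum
    makes the induction go through. *)
Lemma qtail_prod_bounds (R : realFieldType) (x : R) (k j : nat) :
  0 <= x <= 2^-1 ->
  1 - 2 * x ^+ k.+1 + 2 * x ^+ (k.+1 + j) <= qtail_prod x k (k.+1 + j) <= 1.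
Proof.
move=> hx; elim: j => [|j /andP[IH1 IH2]].
  by rewrite addn0 /qtail_prod big_geq // lexx andbT; lra.
rewrite addnS /qtail_prod big_nat_recr ?leq_addr //= -/(qtail_prod _ _ _).
have [x0 x1] := andP hx; have [a0 a1] := andP (expr_le_half k hx).
have [y0 y1] : 0 <= x ^+ (k.+1 + j) /\ x ^+ (k.+1 + j) <= 2^-1.
  by apply/andP; exact: expr_le_half.
rewrite [x ^+ (k.+1 + j).+1]exprS.
set P := qtail_prod _ _ _ in IH1 IH2 *; set y := x ^+ (k.+1 + j) in y0 y1 IH1 *.
have Py : P * y <= y by rewrite ler_piMl.
have Py0 : 0 <= P * y by rewrite mulr_ge0 //; lra.
have xy : x * y <= y / 2 by rewrite mulrC ler_wpM2l.
by apply/andP; split; lra.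
Qed.

Lemma qtail_prod_ge0 (R : realFieldType) (x : R) (k N : nat) :
  0 <= x <= 2^-1 -> 0 <= qtail_prod x k N.
Proof.
move=> hx; rewrite /qtail_prod big_nat_cond prodr_ge0 // => -[|i] //.
by case/andP: (factor_itv i hx) => /ltW.
Qed.

Lemma qtail_prod_nonincr (R : realFieldType) (x : R) (k : nat) :
  0 <= x <= 2^-1 -> nonincreasing_seq (qtail_prod x k).
Proof.
move=> hx; apply/nonincreasing_seqP => N.
have [kN|Nk] := ltnP k N; last by rewrite /qtail_prod !big_geq // ltnW.
rewrite {1}/qtail_prod big_nat_recr //= -/(qtail_prod _ _ _).
rewrite ler_piMr ?qtail_prod_ge0 //.
by case: N kN => // N _; case/andP: (factor_itv N hx).
Qed.

Lemma is_cvg_qtail_prod (R : realType) (x : R) (k : nat) :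
  0 <= x <= 2^-1 -> cvgn (qtail_prod x k).
Proof.
move=> hx; apply: nonincreasing_is_cvgn; first exact: qtail_prod_nonincr.
by exists 0 => _ [N _ <-]; exact: qtail_prod_ge0.
Qed.

Lemma qtail_ge (R : realType) (x : R) (k : nat) :
  0 <= x <= 2^-1 -> 1 - 2 * x ^+ k.+1 <= qtail x k.
Proof.
move=> hx; apply: limr_ge; first exact: is_cvg_qtail_prod.
near=> N.
have kN : (k.+1 <= N)%N by near: N; exact: nbhs_infty_ge.
have := qtail_prod_bounds k (N - k.+1) hx; rewrite subnKC // => /andP[h _].
apply: le_trans h; rewrite lerDl mulr_ge0 // exprn_ge0 //.
by case/andP: hx.
Unshelve. all: by end_near. Qed.

Lemma qtail_le (R : realType) (x : R) (k : nat) :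
  0 <= x <= 2^-1 -> qtail x k <= 1 - x ^+ k.+1.
Proof.
move=> hx; have := nonincreasing_cvgn_ge (qtail_prod_nonincr k hx)
  (is_cvg_qtail_prod (k := k) hx) k.+2.
by rewrite /qtail_prod big_nat1.
Qed.

Lemma qpoch_qtail (R : realType) (x : R) (k : nat) :
  0 <= x <= 2^-1 -> qpoch x k * qtail x k = qtail x 0.
Proof.
move=> hx; apply/esym/cvg_lim => //; rewrite -(cvg_shiftn k.+1) /=.
rewrite (_ : (fun N => _) = fun N => qpoch x k * qtail_prod x k (N + k.+1)).
  by apply: cvgMr; rewrite (cvg_shiftn k.+1); exact: is_cvg_qtail_prod.
by apply/funext => N; rewrite -big_cat_nat //= leq_addl.
Qed.

(** The general bound [qtail_ge] is void at k = 0, x = 1/2; splitting off the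
    first factor leaves 1/2 * (1 - 2 x^2) >= 1/4. *)
Lemma qtail0_ge (R : realType) (x : R) :
  0 <= x <= 2^-1 -> 4^-1 <= qtail x 0.
Proof.
move=> hx; rewrite -(@qpoch_qtail R x 1) // /qpoch big_nat1 expr1.
have := @qtail_ge R x 1 hx; rewrite expr2; case/andP: hx => x0 x1.
set T := qtail x 1 => hT.
have h : 2^-1 <= T by nra.
have h2 : 2^-1 <= 1 - x by lra.
by nra.
Qed.

Lemma qtail_itv (R : realType) (x : R) (k : nat) :
  0 <= x <= 2^-1 -> 0 < qtail x k <= 1.
Proof.
move=> hx; apply/andP; split; last first.
  apply: le_trans (qtail_le k hx) _.
  by case/andP: (factor_itv k hx).
have := qtail0_ge hx; rewrite -(qpoch_qtail k hx) => h.
have /andP[h0 _] := qpoch_itv k hx.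
by rewrite -(pmulr_rgt0 _ h0); apply: lt_le_trans h; rewrite invr_gt0.
Qed.

Lemma cvg_tail_error (R : realType) (x : R) : 0 <= x <= 2^-1 ->
  (1 - 2 * x ^+ n @[n --> \oo] --> (1 : R))%classic.
Proof.
move=> /andP[x0 x1].
suff : (1 - 2 * x ^+ n @[n --> \oo] --> (1 - 2 * 0 : R))%classic by rewrite mulr0 subr0.
apply: cvgB; first exact: cvg_cst.
by apply: cvgMr; apply: cvg_expr; rewrite ger0_norm //; lra.
Qed.

(** * Closed forms of the two masses *)

Lemma card_inv_itv (R : realFieldType) (F : finFieldType) :
  0 <= (#|F|%:R^-1 : R) <= 2^-1.
Proof.
have F1 : (1 < #|F|)%N by exact: card_finNzRing_gt1.
by rewrite invr_ge0 ler0n lef_pV2 ?posrE ?ltr0n ?(ltnW F1) // ler_nat.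
Qed.

Lemma corank_mass_ge0 (R : realType) (F : finFieldType) (n m k : nat) :
  0 <= corank_mass R F n m k.
Proof. by rewrite /corank_mass divr_ge0. Qed.

Lemma corank_mass_eq0 (R : realType) (F : finFieldType) (n m k : nat) :
  (n < k)%N -> corank_mass R F n m k = 0.
Proof.
move=> nk; rewrite /corank_mass (_ : [set _ | _] = finset.set0) ?cards0 ?mul0r //.
by apply/setP => M; rewrite !inE; apply/negbTE; lia.
Qed.

Lemma corank_mass_sum (R : realType) (F : finFieldType) (n m K : nat) :
  (n < K)%N -> \sum_(0 <= k < K) corank_mass R F n m k = 1.
Proof.
move=> nK; rewrite /corank_mass -mulr_suml -natr_sum.
rewrite (_ : (\sum_(0 <= k < K) _)%N = #|{: 'M[F]_(n, n + m)}|).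
  rewrite mulfV // pnatr_eq0 card_mx -lt0n expn_gt0.
  by rewrite (ltn_trans _ (card_finNzRing_gt1 F)).
transitivity (\sum_(0 <= k < K) \sum_(M : 'M[F]_(n, n + m)) (n - \rank M == k))%N.
  by apply: eq_bigr => k _; rewrite cardsE -sum1_card big_mkcond.
rewrite exchange_big -sum1_card /=; apply: eq_bigr => M _.
have lt_cK : (n - \rank M < K)%N by lia.
rewrite big_mkord (bigD1 (Ordinal lt_cK)) //= eqxx big1 ?addn0 // => i ne_i.
by case: eqP => // e; case/negP: ne_i; apply/eqP/val_inj; rewrite /= e.
Qed.

Lemma corank_massE (R : realType) (F : finFieldType) (n m k : nat) :
  let x := #|F|%:R^-1 : R in (k <= n)%N ->
  corank_mass R F n m k * (qpoch x k * qpoch x (n - k) * qpoch x (m + k))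
  = x ^+ (k * (m + k)) * qpoch x (n + m) * qpoch x n.
Proof.
move=> x kn; set r := (n - k)%N; set q : R := #|F|%:R.
have q0 : q != 0 by rewrite pnatr_eq0 -lt0n (ltn_trans _ (card_finNzRing_gt1 F)).
have -> : corank_mass R F n m k =
    (rank_count F n (n + m) r)%:R / q ^+ (n * (n + m)).
  rewrite /corank_mass /rank_count card_mx natrX; congr (_%:R / _).
  apply: eq_card => M; rewrite !inE; have := rank_leq_row M; rewrite /r.
  by move: (\rank M) => s; lia.
have eC := rank_count_frames R F n (n + m) r.
have e1 := qfall_qpoch 0 r q0; have e2 := qfall_qpoch k r q0.
have e3 := qfall_qpoch (m + k) r q0.
rewrite /= -/q -/x in eC e1 e2 e3.
have en : (k + r = n)%N by rewrite /r; lia.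
have enm : (m + k + r = n + m)%N by lia.
rewrite {1}/qpoch big_geq // mulr1 add0n in e1.
rewrite en in e2; rewrite enm in e3.
have xq : x ^+ (k * (m + k)) * q ^+ (k * (m + k)) = 1.
  by rewrite -exprMn mulVf // expr1n.
(* The counting formula leaves q-exponents whose sum is k (m + k) only because
   r = n - k. *)
have ex : q ^+ (r * r) * q ^+ (n * (n + m)) =
    q ^+ (n * r) * q ^+ ((n + m) * r) * q ^+ (k * (m + k)).
  by rewrite -!exprD -en; congr (_ ^+ _); nia.
apply: (mulfI (expf_neq0 (r * r) q0)).
set c := (rank_count _ _ _ _)%:R in eC *.
apply: (mulIf (expf_neq0 (n * (n + m)) q0)).
transitivity (c * (q ^+ (r * r) * qpoch x r) * qpoch x k * qpoch x (m + k)).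
  rewrite -[RHS]mul1r -(mulVf (expf_neq0 (n * (n + m)) q0)); ring.
rewrite -e1 eC.
transitivity ((qfall q n r * qpoch x k) * (qfall q (n + m) r * qpoch x (m + k))).
  by ring.
rewrite e2 e3.
transitivity (q ^+ (n * r) * q ^+ ((n + m) * r)
    * (x ^+ (k * (m + k)) * q ^+ (k * (m + k))) * qpoch x n * qpoch x (n + m)).
  by rewrite xq; ring.
transitivity (q ^+ (r * r) * q ^+ (n * (n + m)) * x ^+ (k * (m + k))
    * qpoch x n * qpoch x (n + m)).
  by rewrite ex; ring.
by ring.
Qed.

Lemma limit_massE (R : realType) (q m k : nat) :
  let x := q%:R^-1 : R in 0 <= x <= 2^-1 ->
  limit_mass R q m k * (qpoch x k * qpoch x (m + k))
  = x ^+ (k * (m + k)) * qtail x 0.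
Proof.
move=> x hx; rewrite /limit_mass euler_tailE -/x div1r -exprVn -/x.
rewrite (_ : \prod_(1 <= i < _) _ = qpoch x (m + k)); last first.
  by apply: eq_bigr => i _; rewrite div1r exprVn.
rewrite -(qpoch_qtail k hx).
have /andP[/lt0r_neq0 h _] := qpoch_itv (m + k) hx.
by field.
Qed.

Lemma limit_mass_ge0 (R : realType) (q m k : nat) :
  0 <= (q%:R^-1 : R) <= 2^-1 -> 0 <= limit_mass R q m k.
Proof.
move=> hx; have := limit_massE m k hx.
have /andP[h1 _] := qpoch_itv (m + k) hx; have /andP[h2 _] := qpoch_itv k hx.
move=> e; rewrite -(pmulr_lge0 _ (mulr_gt0 h2 h1)) e mulr_ge0 //.
by have := qtail0_ge hx; lra.
Qed.

(** The powers of x and the factors indexed by k and m + k are common to both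
    closed forms and cancel. *)
Lemma mass_ratio (R : realType) (F : finFieldType) (n m k : nat) :
  let x := #|F|%:R^-1 : R in (k <= n)%N ->
  corank_mass R F n m k * qtail x (n + m) * qpoch x (n - k)
  = limit_mass R #|F| m k * qpoch x n.
Proof.
move=> x kn; have hx := card_inv_itv R F.
have eP := @corank_massE R F n m k kn; have eL := limit_massE m k hx.
rewrite /= -/x in hx eP eL.
have /andP[/lt0r_neq0 h1 _] := qpoch_itv (m + k) hx.
have /andP[/lt0r_neq0 h2 _] := qpoch_itv k hx.
apply: (mulIf (mulf_neq0 h2 h1)).
rewrite [RHS]mulrAC eL -(qpoch_qtail (n + m) hx).
transitivity (corank_mass R F n m k * (qpoch x k * qpoch x (n - k) * qpoch x (m + k))
  * qtail x (n + m)); first by ring.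
by rewrite eP; ring.
Qed.

(** * The total variation distance *)

(** Positive corank is less likely in finite size than in the limit: the ratio
    of the masses is at most (1 - x^n) / T_(n+m) <= 1. *)
Lemma corank_mass_le_limit (R : realType) (F : finFieldType) (n m k : nat) :
  (0 < n)%N -> (0 < k)%N ->
  corank_mass R F n m k <= limit_mass R #|F| m k.
Proof.
move=> n0 k0; have hx := card_inv_itv R F; set x : R := #|F|%:R^-1 in hx.
have [kn|nk] := leqP k n; last by rewrite corank_mass_eq0 // limit_mass_ge0.
have /andP[T0 _] := qtail_itv (n + m) hx.
have /andP[Q0 _] := qpoch_itv (n - k) hx.
rewrite -(ler_pM2r T0) -(ler_pM2r Q0) (@mass_ratio R F n m k kn) -/x -[leRHS]mulrA.
apply: ler_wpM2l; first exact: limit_mass_ge0.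
have le_Q : qpoch x n <= qpoch x (n - k) * (1 - x ^+ n).
  rewrite -{1}(prednK n0) qpochS prednK //; apply: ler_wpM2r.
    by rewrite -(prednK n0); case/andP: (factor_itv n.-1 hx) => /ltW.
  by apply: qpoch_nonincr => //; lia.
apply: (le_trans le_Q); rewrite mulrC; apply: ler_wpM2r; first exact: ltW.
apply: le_trans (qtail_ge (n + m) hx); rewrite lerD2l lerN2.
case/andP: (hx) => x0 x1; have xn0 : 0 <= x ^+ n by rewrite exprn_ge0.
have xm : x ^+ m <= 1 by rewrite exprn_ile1 //; lra.
rewrite exprS exprD mulrA; have : 2 * x <= 1 by lra.
move: (x ^+ m) (exprn_ge0 m x0) xm => y y0 y1 x2.
have := ler_pM (mulr_ge0 (ler0n R 2) x0) (mulr_ge0 xn0 y0) x2 (ler_piMr xn0 y1).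
by rewrite mul1r.
Qed.

Lemma limit_mass0 (R : realType) (F : finFieldType) (n m : nat) :
  let x := #|F|%:R^-1 : R in
  limit_mass R #|F| m 0 = corank_mass R F n m 0 * qtail x (n + m).
Proof.
move=> x; have hx := card_inv_itv R F.
have /andP[/lt0r_neq0 Q0 _] := qpoch_itv n hx.
by apply: (mulIf Q0); rewrite -(@mass_ratio R F n m 0) // subn0.
Qed.

(** The mass at 0 is the finite product of the 1 - x^i with m < i <= n + m, which
    dominates the infinite product over all i >= 1. *)
Lemma corank_mass0_itv (R : realType) (F : finFieldType) (n m : nat) :
  4^-1 <= corank_mass R F n m 0 <= 1.
Proof.
have hx := card_inv_itv R F; set x : R := #|F|%:R^-1 in hx.
have := @corank_massE R F n m 0 (leq0n n).
rewrite /= -/x subn0 mul0n expr0 mul1r addn0 {1}/qpoch big_geq // mul1r.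
have /andP[Qn0 _] := qpoch_itv n hx; have /andP[Qm0 Qm1] := qpoch_itv m hx.
rewrite (mulrC (qpoch x n)) mulrA => /(mulIf (lt0r_neq0 Qn0)) e.
have le1 : qpoch x (n + m) <= qpoch x m by apply: qpoch_nonincr => //; lia.
have := qtail0_ge hx; rewrite -(qpoch_qtail (n + m) hx) => ge4.
have /andP[T0 T1] := qtail_itv (n + m) hx.
have /andP[Q0 _] := qpoch_itv (n + m) hx.
have ge4' : 4^-1 <= qpoch x (n + m) by apply: le_trans ge4 _; rewrite ler_piMr // ltW.
apply/andP; split; last by rewrite -(ler_pM2r Qm0) e mul1r.
apply: le_trans ge4' _; rewrite -e ler_piMr //.
exact: corank_mass_ge0.
Qed.

(** The ratio of the masses is at least (x)_n / (x)_(n-k), and this finite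
    product dominates the tail T_(n-k). *)
Lemma limit_mass_le_corank (R : realType) (F : finFieldType) (n m k : nat) :
  let x := #|F|%:R^-1 : R in (k <= n)%N ->
  limit_mass R #|F| m k * qtail x (n - k) <= corank_mass R F n m k.
Proof.
move=> x kn; have hx := card_inv_itv R F; rewrite -/x in hx.
have /andP[Q0 _] := qpoch_itv (n - k) hx.
rewrite -(ler_pM2r Q0) -[leLHS]mulrA (mulrC (qtail _ _)) (qpoch_qtail _ hx).
have /andP[T0 T1] := qtail_itv (n + m) hx.
have P0 := corank_mass_ge0 R F n m k.
apply: (@le_trans _ _ (corank_mass R F n m k * qtail x (n + m) * qpoch x (n - k))).
  rewrite (@mass_ratio R F n m k kn) -/x -(qpoch_qtail n hx).
  apply: ler_wpM2l; first exact: limit_mass_ge0.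
  have /andP[Qn0 _] := qpoch_itv n hx; have /andP[_ Tn1] := qtail_itv n hx.
  by rewrite ler_piMr // ltW.
by rewrite ler_pM2r // ler_piMr.
Qed.

(** Compare with the corank mass of size n = K + j: each term with k < K loses at
    most the factor 1 - 2 x^j, which tends to 1 as j grows. *)
Lemma limit_mass_sum_le1 (R : realType) (F : finFieldType) (m K : nat) :
  \sum_(0 <= k < K) limit_mass R #|F| m k <= 1.
Proof.
have hx := card_inv_itv R F; set x : R := #|F|%:R^-1 in hx.
set S := \sum_(0 <= k < K) _.
have S0 : 0 <= S by apply: sumr_ge0 => k _; exact: limit_mass_ge0.
have le1 j : S * (1 - 2 * x ^+ j) <= 1.
  rewrite -[leRHS](@corank_mass_sum R F (K + j) m (K + j).+1) //.
  rewrite (@big_cat_nat _ _ _ K) //=; last by lia.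
  apply: le_trans (_ : \sum_(0 <= k < K) corank_mass R F (K + j) m k <= _); last first.
    by rewrite lerDl sumr_ge0 // => k _; exact: corank_mass_ge0.
  rewrite /S mulr_suml; apply: ler_sum_nat => k /= kK.
  apply: le_trans (@limit_mass_le_corank R F (K + j) m k _); last by lia.
  apply: ler_wpM2l; first exact: limit_mass_ge0.
  apply: le_trans (qtail_ge _ hx); rewrite lerD2l lerN2 ler_wpM2l //.
  case/andP: (hx) => x0 x1.
  by apply: ler_wiXn2l => //; [lra|lia].
have cvgS : (S * (1 - 2 * x ^+ j) @[j --> \oo] --> S * 1)%classic.
  by apply: cvgMr; exact: cvg_tail_error.
rewrite mulr1 in cvgS; rewrite -(cvg_lim _ cvgS) //.
by apply: limr_le; [apply/cvg_ex; exists S | exact: nearW].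
Qed.

(** Only the term at 0 of the corank mass of size n exceeds that of the limit,
    and its excess is at most 2 x^n. *)
Lemma limit_mass_sum_ge (R : realType) (F : finFieldType) (m n : nat) :
  let x := #|F|%:R^-1 : R in (0 < n)%N ->
  1 - 2 * x ^+ n <= \sum_(0 <= k < n.+1) limit_mass R #|F| m k.
Proof.
move=> x n0; have hx := card_inv_itv R F; rewrite -/x in hx.
have := @corank_mass_sum R F n m n.+1 (ltnSn n).
rewrite !big_nat_recl // (limit_mass0 R F n m) -/x => e1.
have : \sum_(0 <= k < n) corank_mass R F n m k.+1 <=
  \sum_(0 <= k < n) limit_mass R #|F| m k.+1.
  by apply: ler_sum => k _; exact: corank_mass_le_limit.
have /andP[p0 p1] := corank_mass0_itv R F n m.
have := qtail_ge (n + m) hx.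
have : x ^+ (n + m).+1 <= x ^+ n.
  by case/andP: (hx) => x0 x1; apply: ler_wiXn2l => //; [lra|lia].
have /andP[T0 T1] := qtail_itv (n + m) hx.
move: e1 p0 p1; set p := corank_mass R F n m 0; set T := qtail _ _ in T0 T1 *.
by move=> *; nra.
Qed.

Lemma cvg_limit_mass_sum (R : realType) (F : finFieldType) (m : nat) :
  (\sum_(0 <= k < n) limit_mass R #|F| m k @[n --> \oo] --> (1 : R))%classic.
Proof.
have hx := card_inv_itv R F.
rewrite -cvg_shiftS; apply: (@squeeze_cvgr _ _ _ _
  (fun n => 1 - 2 * (#|F|%:R^-1 : R) ^+ n) (fun=> 1)); last 2 first.
- exact: cvg_tail_error.
- exact: cvg_cst.
near=> n; rewrite limit_mass_sum_ge ?limit_mass_sum_le1 //.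
by near: n; exact: nbhs_infty_gt.
Unshelve. all: by end_near. Qed.

(** The differences P_n(k) - L(k) have total 0 and those with k >= 1 are at most
    0, so that half the sum of their absolute values is the difference at 0. *)
Lemma tv_distE (R : realType) (F : finFieldType) (n m : nat) :
  let x := #|F|%:R^-1 : R in (0 < n)%N ->
  tv_dist (corank_mass R F n m) (limit_mass R #|F| m) =
  (corank_mass R F n m 0 * (1 - qtail x (n + m)))%:E.
Proof.
move=> x n0; have hx := card_inv_itv R F; rewrite -/x in hx.
have /andP[T0 T1] := qtail_itv (n + m) hx.
have p0 := corank_mass_ge0 R F n m 0.
set P := corank_mass R F n m; set L := limit_mass R #|F| m.
set D := _ * _.
have L0 : L 0 = P 0 * qtail x (n + m) by exact: limit_mass0.
rewrite /tv_dist -nneseries_esumT; last by move=> k; rewrite lee_fin.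
suff -> : (\big[+%E/0%R]_(0 <= k <oo) `|P k - L k|%:E)%E = (2 * D)%:E.
  by rewrite -EFinM mulrA mulVf // mul1r.
apply: cvg_lim => //.
under eq_cvg do rewrite sumEFin.
apply: cvg_EFin; first by apply: nearW.
(* From K = n + 1 on, the partial sums of P are exactly 1, so that only those
   of L vary. *)
rewrite -(cvg_shiftn n.+1) /=.
rewrite (_ : (fun K => _) = fun K =>
    2 * D + (\sum_(0 <= k < K + n.+1) L k - 1)).
  suff : (2 * D + (\sum_(0 <= k < K + n.+1) L k - 1) @[K --> \oo]
    --> (2 * D + (1 - 1) : R))%classic by rewrite subrr addr0.
  apply: cvgD; first exact: cvg_cst.
  apply: cvgB; last exact: cvg_cst.
  rewrite (cvg_shiftn n.+1 (fun K => \sum_(0 <= k < K) L k)).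
  exact: cvg_limit_mass_sum.
apply/funext => K /=.
rewrite -[X in _ + (_ - X)](@corank_mass_sum R F n m (K + n.+1)) ?leq_addl //.
rewrite addnS !big_nat_recl //= -/P ger0_norm; last first.
  by rewrite L0 -[X in X - _]mulr1 -mulrBr mulr_ge0 // subr_ge0.
rewrite (eq_bigr (fun k => L k.+1 - P k.+1)); last first.
  by move=> k _; rewrite distrC ger0_norm // subr_ge0 corank_mass_le_limit.
by rewrite sumrB L0 /D; ring.
Qed.

Theorem theorem1p1 (R : realType) (F : finFieldType) (q n m : nat)
    (hq : #|F| = q) (hn : (1 <= n)%N) :
  ((1 / (8 * q%:R ^+ (n + m + 1)) : R)%:E
     <= tv_dist (corank_mass R F n m) (limit_mass R q m))%E /\
  (tv_dist (corank_mass R F n m) (limit_mass R q m)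
     <= (3 / q%:R ^+ (n + m + 1) : R)%:E)%E.
Proof.
rewrite -hq tv_distE // !lee_fin addn1 invfM mulrA div1r -exprVn.
have hx := card_inv_itv R F; set x : R := #|F|%:R^-1 in hx *.
have /andP[p4 p1] := corank_mass0_itv R F n m.
have T_ge := qtail_ge (n + m) hx; have T_le := qtail_le (n + m) hx.
have y0 : 0 <= x ^+ (n + m).+1 by rewrite exprn_ge0 //; case/andP: hx.
split.
  apply: le_trans (_ : 4^-1 * x ^+ (n + m).+1 <= _); first by lra.
  by apply: ler_pM => //; lra.
apply: le_trans (_ : 1 * (2 * x ^+ (n + m).+1) <= _); last by lra.
by apply: ler_pM => //; lra.
Qed.
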